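(* Let $A$ be a complex commutative semi-simple completely regular Banach algebra, $\sigma: A \rightarrow A$ an algebra automorphism, and $\widetilde{\sigma}:\Delta(A)\to\Delta(A)$, $\widetilde{\sigma}(\mu)=\mu\circ\sigma^{-1}$, the induced homeomorphism of the character space $\Delta(A)$ in the Gelfand topology. Then the following three properties are equivalent: (1) the set $\mathrm{Per}^\infty(\Delta(A))$ of non-periodic points of $(\Delta(A),\widetilde{\sigma})$ is dense in $\Delta(A)$; (2) every non-zero two-sided ideal $I \subseteq A \rtimes_{\sigma} \mathbb{Z}$ is such that $I \cap A \neq \{0\}$; (3) $A$ is a maximal abelian subalgebra of $A \rtimes_{\sigma} \mathbb{Z}$.
   Context: $\Delta(A)$ denotes the character space (non-zero multiplicative linear functionals) of $A$, endowed with the Gelfand topology, and $\widehat{a}$ denotes the Gelfand transform of $a\in A$. A commutative Banach algebra $A$ is completely regular if for every closed subset $F \subseteq \Delta(A)$ and every $\phi_0 \in \Delta(A) \setminus F$ there exists $a \in A$ such that $\widehat{a}(\phi) = 0$ for all $\phi \in F$ and $\widehat{a}(\phi_0) \neq 0$. $A$ is not assumed unital. $\mathrm{Per}^\infty(\Delta(A))=\{\mu\in\Delta(A) : \widetilde{\sigma}^n(\mu)\neq\mu \text{ for all } n\in\mathbb{Z}\setminus\{0\}\}$. The crossed product $A \rtimes_{\sigma} \mathbb{Z}$ is the associative complex algebra of all finite formal sums $\sum_{n\in\mathbb{Z}} a_n\delta^n$ with $a_n\in A$, with coefficientwise addition and scalar multiplication, and with multiplication determined by $(a_n\delta^n)*(b_m\delta^m)=a_n\cdot\sigma^n(b_m)\,\delta^{n+m}$.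 The algebra $A$ is identified with the abelian subalgebra $\{a_0\delta^0 : a_0\in A\}$. *)

(* Defs.v *)
From HB Require Import structures.
From mathcomp Require Import all_boot all_order all_algebra finmap.
From mathcomp Require Import complex.
From mathcomp Require Import all_classical all_reals.
From mathcomp Require Import topology normedtype.
(* The notations of monalg are incompatible with those of analysis. *)
From mathcomp Require Import -(notations) monalg.

Set Implicit Arguments.
Unset Strict Implicit.
Unset Printing Implicit Defensive.

Import Order.TTheory GRing.Theory Num.Theory.
Import numFieldNormedType.Exports.

Local Open Scope classical_set_scope.
Local Open Scope ring_scope.

(* Possibly non-unital, hence the multiplication is not that of a ringType. *)
HB.mixin Record isComBanachAlgebra (R : realType) A
    of CompleteNormedModule R[i] A := {
  bmul : A -> A -> A;
  bmulA : associative bmul;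
  bmulC : commutative bmul;
  bmulDl : left_distributive bmul +%R;
  bmulZl : forall (c : R[i]) (a b : A), bmul (c *: a) b = c *: bmul a b;
  ler_norm_bmul : forall a b : A, `|bmul a b| <= `|a| * `|b| }.

#[short(type="comBanachAlgType")]
HB.structure Definition ComBanachAlgebra (R : realType) :=
  { A of isComBanachAlgebra R A & CompleteNormedModule R[i] A }.

Definition linear_subspace (K : pzRingType) (V : lmodType K) (W : set V) :=
  [/\ W 0,
      forall x y, W x -> W y -> W (x + y) &
      forall (c : K) x, W x -> W (c *: x)].

Section Radical.
Context {R : realType} {A : comBanachAlgType R}.
Implicit Types (I M : set A).

Definition is_ideal I :=
  linear_subspace I /\ forall a x, I x -> I (bmul a x).

(* I is modular (also called regular): A/I has an identity, the class of u. *)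
Definition modular I := exists u : A, forall a, I (bmul a u - a).

Definition maximal_modular_ideal M :=
  [/\ is_ideal M, modular M, M <> setT &
      forall I, is_ideal I -> M `<=` I -> I <> setT -> I = M].

Definition radical : set A :=
  \bigcap_(M in [set M | maximal_modular_ideal M]) M.

End Radical.

Definition semisimple (R : realType) (A : comBanachAlgType R) :=
  @radical R A = [set 0].

Section CharacterSpace.
Context {R : realType}.
Variable A : comBanachAlgType R.

(* The topology on the ambient space is that of pointwise convergence, so the
   subset topology on the characters is the Gelfand topology. *)
Definition is_character : set {ptws A -> R[i]^o} :=
  [set phi | [/\ scalar phi,
                 forall a b, phi (bmul a b) = phi a * phi b &
                 exists a, phi a <> 0]].

Definition character_space : topologicalType := set_type is_character.

Definition character_fun (phi : character_space) : A -> R[i] := set_val phi.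

Definition gelfand (a : A) (phi : character_space) : R[i]^o :=
  character_fun phi a.

Definition completely_regular :=
  forall (F : set character_space) (phi0 : character_space),
    closed F -> ~ F phi0 ->
    exists a : A, (forall phi, F phi -> gelfand a phi = 0)
                  /\ gelfand a phi0 <> 0.

Lemma character_funP (phi : character_space) : is_character (character_fun phi).
Proof. exact: set_valP. Qed.

Definition mk_character (phi : A -> R[i]) (phiP : is_character phi) :
  character_space := SigSub (mem_set phiP).

Lemma mk_characterE phi (phiP : is_character phi) :
  character_fun (mk_character phiP) = phi.
Proof. by []. Qed.

Lemma character_fun_inj : injective character_fun.
Proof. exact: val_inj. Qed.

(* The Gelfand topology is the coarsest one making all gelfand a continuous. *)
Lemma cvg_character_space (F : set_system character_space)
    (phi : character_space) : Filter F ->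
  F --> phi <-> forall a, gelfand a @ F --> gelfand a phi.
Proof.
move=> FF; have coarse U : nbhs phi U <->
    exists2 V : set {ptws A -> R[i]^o},
      nbhs (set_val phi) V & set_val @^-1` V `<=` U.
  split.
    rewrite nbhsE => -[B [[V oV <-] Vphi] VU]; exists V => //.
    exact: open_nbhs_nbhs.
  move=> [V Vphi VU]; apply: filterS VU _.
  exact: (@initial_continuous _ _ (set_val : character_space -> _)).
have -> : F --> phi <-> {ptws, set_val @ F --> set_val phi}.
  split=> [Fphi V Vphi|Fphi U /coarse[V Vphi VU]].
    by apply: Fphi; apply/coarse; exists V.
  by apply: filterS VU _; exact: Fphi.
exact: (@pointwise_cvgP _ _ _ _ _).
Qed.

End CharacterSpace.

(* No continuity is required. *)
Record algebra_aut (R : realType) (A : comBanachAlgType R) := AlgebraAut {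
  aut_fun :> A -> A;
  aut_inv : A -> A;
  aut_linear : linear aut_fun;
  aut_mul : forall a b, aut_fun (bmul a b) = bmul (aut_fun a) (aut_fun b);
  aut_funK : cancel aut_fun aut_inv;
  aut_invK : cancel aut_inv aut_fun }.

(* Integer powers of f, where finv is the inverse of f. *)
Definition iterz (T : Type) (f finv : T -> T) (n : int) : T -> T :=
  match n with Posz k => iter k f | Negz k => iter k.+1 finv end.

Section Automorphism.
Context {R : realType} {A : comBanachAlgType R}.
Variable sigma : algebra_aut A.

Lemma aut_inv_linear : linear (aut_inv sigma).
Proof.
move=> c a b; apply: (can_inj (aut_funK sigma)).
by rewrite aut_linear !aut_invK.
Qed.

Lemma aut_inv_mul a b :
  aut_inv sigma (bmul a b) = bmul (aut_inv sigma a) (aut_inv sigma b).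
Proof.
apply: (can_inj (aut_funK sigma)).
by rewrite aut_mul !aut_invK.
Qed.

Definition inverse_aut : algebra_aut A :=
  AlgebraAut aut_inv_linear aut_inv_mul (aut_invK sigma) (aut_funK sigma).

Definition aut_pow (n : int) : A -> A := iterz sigma (aut_inv sigma) n.

Lemma comp_aut_inv_character (mu : character_space A) :
  is_character (character_fun mu \o aut_inv sigma).
Proof.
have [lin mul [a a0]] := character_funP mu; split.
- by move=> c x y /=; rewrite aut_inv_linear lin.
- by move=> x y /=; rewrite aut_inv_mul mul.
- by exists (sigma a); rewrite /= aut_funK.
Qed.

Definition induced_map (mu : character_space A) : character_space A :=
  mk_character (comp_aut_inv_character mu).

End Automorphism.

Section InducedDynamics.
Context {R : realType} {A : comBanachAlgType R}.
Variable sigma : algebra_aut A.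

Lemma induced_mapK :
  cancel (induced_map sigma) (induced_map (inverse_aut sigma)).
Proof.
move=> mu; apply: character_fun_inj; rewrite !mk_characterE.
by apply/funext => a /=; rewrite aut_funK.
Qed.

Lemma induced_mapVK :
  cancel (induced_map (inverse_aut sigma)) (induced_map sigma).
Proof.
move=> mu; apply: character_fun_inj; rewrite !mk_characterE.
by apply/funext => a /=; rewrite aut_invK.
Qed.

Definition induced_pow (n : int) : character_space A -> character_space A :=
  iterz (induced_map sigma) (induced_map (inverse_aut sigma)) n.

Definition nonperiodic_points : set (character_space A) :=
  [set mu | forall n : int, n <> 0 -> induced_pow n mu <> mu].

End InducedDynamics.

(* Finitely supported functions int -> A with coefficientwise addition; sigma
   only enters through the multiplication below. *)
Definition crossed_product (R : realType) (A : comBanachAlgType R)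
  (sigma : algebra_aut A) : Type := malg int A.

HB.instance Definition _ (R : realType) (A : comBanachAlgType R)
  (sigma : algebra_aut A) := GRing.Zmodule.on (crossed_product sigma).

Section CrossedProduct.
Context {R : realType} {A : comBanachAlgType R}.
Variable sigma : algebra_aut A.
Implicit Types (f g : crossed_product sigma) (c : R[i]).

Definition cp_support f : seq int := msupp f.

Definition cp_coeff (n : int) f : A := mcoeff n f.

(* The element a delta^n. *)
Definition cp_monomial (n : int) (a : A) : crossed_product sigma := mkmalgU n a.

Definition cp_scale c f : crossed_product sigma :=
  \sum_(n <- cp_support f) cp_monomial n (c *: cp_coeff n f).

Lemma cp_coeff_scale c f n : cp_coeff n (cp_scale c f) = c *: cp_coeff n f.
Proof.
rewrite /cp_scale /cp_coeff raddf_sum /=.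
have [nf|nf] := msuppP f n.
  rewrite (big_rem n) //= mcoeffU eqxx mulr1n big1_seq ?addr0 // => m /= mf.
  rewrite mcoeffU; case: eqVneq mf => // ->.
  by rewrite mem_rem_uniqF ?fset_uniq.
rewrite scaler0 big1_seq // => m /= mf.
by rewrite mcoeffU; case: eqVneq mf nf => // -> ->.
Qed.

Lemma cp_eqP f g : (forall n, cp_coeff n f = cp_coeff n g) -> f = g.
Proof. by move/malgP. Qed.

Lemma cp_coeffD n f g : cp_coeff n (f + g) = cp_coeff n f + cp_coeff n g.
Proof. exact: mcoeffD. Qed.

Lemma cp_scaleA c d f : cp_scale c (cp_scale d f) = cp_scale (c * d) f.
Proof. by apply: cp_eqP => n; rewrite !cp_coeff_scale scalerA. Qed.

Lemma cp_scale1 : left_id 1 cp_scale.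
Proof. by move=> f; apply: cp_eqP => n; rewrite cp_coeff_scale scale1r. Qed.

Lemma cp_scaleDr : right_distributive cp_scale +%R.
Proof.
move=> c f g; apply: cp_eqP => n.
by rewrite !(cp_coeffD, cp_coeff_scale) scalerDr.
Qed.

Lemma cp_scaleDl f : {morph cp_scale^~ f : c d / c + d}.
Proof.
move=> c d; apply: cp_eqP => n.
by rewrite !(cp_coeffD, cp_coeff_scale) scalerDl.
Qed.

HB.instance Definition _ := GRing.Zmodule_isLmodule.Build R[i]
  (crossed_product sigma) cp_scaleA cp_scale1 cp_scaleDr cp_scaleDl.

Definition cp_mul f g : crossed_product sigma :=
  \sum_(n <- cp_support f) \sum_(m <- cp_support g)
    cp_monomial (n + m) (bmul (cp_coeff n f) (aut_pow sigma n (cp_coeff m g))).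

Lemma cp_mul_monomial n m a b :
  cp_mul (cp_monomial n a) (cp_monomial m b) =
  cp_monomial (n + m) (bmul a (aut_pow sigma n b)).
Proof.
have bmul0l x : bmul 0 x = 0 :> A.
  by have := bmulZl (0 : R[i]) 0 x; rewrite !scale0r.
have bmul0r x : bmul x 0 = 0 :> A by rewrite bmulC bmul0l.
have pow0 : aut_pow sigma n 0 = 0.
  have F0 : sigma 0 = 0.
    by have := aut_linear sigma (-1) 0 0; rewrite !scaleN1r oppr0 addr0 addNr.
  have V0 : aut_inv sigma 0 = 0 by rewrite -{1}F0 aut_funK.
  by rewrite /aut_pow /iterz; case: n => k; rewrite iter_fix.
have mono0 k : cp_monomial k 0 = 0 by exact: raddf0.
rewrite /cp_mul /cp_support !msuppU.
have [->|a0] := eqVneq a 0; first by rewrite big_nil bmul0l mono0.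
rewrite big_seq_fset1.
have [->|b0] := eqVneq b 0; first by rewrite big_nil pow0 bmul0r mono0.
by rewrite big_seq_fset1 /cp_coeff !mcoeffUU.
Qed.

(* The copy of A inside the crossed product. *)
Definition cp_base : set (crossed_product sigma) := range (cp_monomial 0).

(* Ideals of the complex algebra: since A may lack a unit, being a linear
   subspace is not implied by being closed under sums and multiplication. *)
Definition two_sided_ideal (I : set (crossed_product sigma)) :=
  linear_subspace I /\
  forall f x, I x -> I (cp_mul f x) /\ I (cp_mul x f).

Definition abelian_subalgebra (B : set (crossed_product sigma)) :=
  [/\ linear_subspace B,
      forall f g, B f -> B g -> B (cp_mul f g) &
      forall f g, B f -> B g -> cp_mul f g = cp_mul g f].

Definition maximal_abelian_subalgebra (B : set (crossed_product sigma)) :=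
  abelian_subalgebra B /\
  forall B', abelian_subalgebra B' -> B `<=` B' -> B' = B.

Definition nonzero_ideals_meet_base :=
  forall I, two_sided_ideal I -> I <> [set 0] -> I `&` cp_base <> [set 0].

End CrossedProduct.

Arguments cp_base {R A} sigma _ : assert.

(* Main.v *)
Require Import Defs.
From mathcomp Require Import all_boot all_order all_algebra finmap.
From mathcomp Require Import complex.
From mathcomp Require Import all_classical all_reals topology normedtype.
From mathcomp Require Import sequences derive.
From mathcomp Require Import -(notations) monalg.
From mathcomp Require Import ring lra.

(** All three properties are equivalent to a fourth one, which only speaks of
    [A] and the dynamics ([fixed_points_support_nothing]): for [n != 0], the
    only element of [A] whose Gelfand transform vanishes off the fixed points
    of the [n]-th power of the induced map is [0].

    What makes this work is that characters separate the points of a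
    semisimple [A] ([semisimple_characters_separate]), so that every identity
    in [A] can be tested pointwise.  With the radical defined through maximal
    modular ideals this is the Gelfand-Mazur theorem: modulo such an ideal,
    every element is a multiple of the modular unit.  Otherwise the resolvent
    [r] of some element exists on the whole plane and tends to [0] at
    infinity.  Averaging [r] over four points [z + i^k s] reproduces [r z] up
    to [O(s^4)], so the function [qnorm (r z) + eps * |z|^2] has no local
    maximum, although it must have one in a large disc
    ([resolvent_absurd]).

    Maximality of [A]: an element [f] commutes with [A] exactly when each
    coefficient of [delta^n] in [f] vanishes off the fixed points of the
    [n]-th power ([base_commutantP]), and the commutant of [A] is itself
    abelian.  So [A] is maximal abelian iff it equals its commutant, that is,
    iff the fourth property holds.

    Ideals: a non-zero element of least support in an ideal can be translated
    so that its coefficient at [0] is non-zero; its commutators with [A] lie in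
    the ideal and have smaller support, hence vanish.  So every non-zero ideal
    meets the commutant of [A]
    ([fixed_points_support_nothing_ideals]).  Conversely a non-zero [a]
    whose transform lives on the fixed points of the [n]-th power puts
    [a - a delta^n] in an ideal all of whose elements have coefficient sum
    [0], and such an ideal misses [A]
    ([ideals_fixed_points_support_nothing]).

    Density: if non-periodic points are dense, a transform vanishing on them is
    zero.  Conversely the fourth property and complete regularity say that the
    closed sets of fixed points have empty interior, and a Baire category
    argument applies because the sets where a Gelfand transform has modulus at
    least [1] are compact ([gabs_ge1_fip]). *)

Set Implicit Arguments.
Unset Strict Implicit.
Unset Printing Implicit Defensive.
Import Order.TTheory GRing.Theory Num.Theory.
Import numFieldNormedType.Exports.
Local Open Scope classical_set_scope.
Local Open Scope ring_scope.

(** * Commutative Banach algebras, characters and powers of the automorphism *)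

Section BanachAlgebra.
Context {R : realType} {A : comBanachAlgType R}.
Implicit Types (a b x y : A) (c : R[i]).

Lemma bmulDr x : {morph bmul x : a b / a + b}.
Proof. by move=> a b; rewrite !(bmulC x) bmulDl. Qed.

Lemma bmulZr c a b : bmul a (c *: b) = c *: bmul a b.
Proof. by rewrite bmulC bmulZl bmulC. Qed.

Lemma bmul0l a : bmul 0 a = 0.
Proof. by have := bmulZl (0 : R[i]) 0 a; rewrite !scale0r. Qed.

Lemma bmul0r a : bmul a 0 = 0.
Proof. by rewrite bmulC bmul0l. Qed.

Lemma bmulNl a b : bmul (- a) b = - bmul a b.
Proof. by rewrite -scaleN1r bmulZl scaleN1r. Qed.

Lemma bmulBl a b x : bmul (a - b) x = bmul a x - bmul b x.
Proof. by rewrite bmulDl bmulNl. Qed.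

Lemma bmulBr a b x : bmul x (a - b) = bmul x a - bmul x b.
Proof. by rewrite !(bmulC x) bmulBl. Qed.

Lemma bmul_sumr a (I : Type) (s : seq I) (P : pred I) (F : I -> A) :
  bmul a (\sum_(i <- s | P i) F i) = \sum_(i <- s | P i) bmul a (F i).
Proof. exact: (big_morph _ (bmulDr a) (bmul0r a)). Qed.

Lemma bmulCA a b x : bmul a (bmul b x) = bmul b (bmul a x).
Proof. by rewrite !bmulA (bmulC a). Qed.

End BanachAlgebra.

Section Characters.
Context {R : realType} {A : comBanachAlgType R}.
Variable phi : character_space A.
Implicit Types (a b : A) (c : R[i]).

Lemma characterM a b :
  character_fun phi (bmul a b) = character_fun phi a * character_fun phi b.
Proof. by have [_ + _] := character_funP phi; exact. Qed.

Lemma characterD a b :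
  character_fun phi (a + b) = character_fun phi a + character_fun phi b.
Proof.
by have [lin _ _] := character_funP phi; rewrite -[a]scale1r lin mul1r scale1r.
Qed.

Lemma character0 : character_fun phi 0 = 0.
Proof. by apply: (addIr (character_fun phi 0)); rewrite -characterD !add0r. Qed.

Lemma characterZ c a : character_fun phi (c *: a) = c * character_fun phi a.
Proof.
have [lin _ _] := character_funP phi.
by rewrite -[c *: a]addr0 lin character0 addr0.
Qed.

Lemma characterB a b :
  character_fun phi (a - b) = character_fun phi a - character_fun phi b.
Proof. by rewrite characterD -scaleN1r characterZ mulN1r. Qed.

Lemma character_sum (I : Type) (r : seq I) (F : I -> A) :
  character_fun phi (\sum_(i <- r) F i) = \sum_(i <- r) character_fun phi (F i).
Proof. exact: (big_morph _ characterD character0). Qed.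

End Characters.

Section IntegerIterates.
Variables (T : Type) (f g : T -> T) (fK : cancel f g) (gK : cancel g f).

Lemma iterzS n x : iterz f g (n + 1) x = f (iterz f g n x).
Proof.
case: n => [n|[|n]]; first by rewrite -PoszD addn1.
  by rewrite /= gK.
have -> : Negz n.+1 + 1 = Negz n by rewrite !NegzE -addn1 PoszD opprD addrNK.
by rewrite [RHS]/= gK.
Qed.

Lemma iterzB1 n x : iterz f g (n - 1) x = g (iterz f g n x).
Proof. by rewrite -[in RHS](subrK 1 n) iterzS fK. Qed.

Lemma iterzD m n x : iterz f g (m + n) x = iterz f g m (iterz f g n x).
Proof.
elim/int_rect: m => [|m IH|m IH]; first by rewrite add0r.
  by rewrite -addn1 PoszD -addrA [1 + n]addrC addrA !iterzS IH.
by rewrite -addn1 PoszD opprD -addrA [-1 + n]addrC addrA !iterzB1 IH.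
Qed.

End IntegerIterates.

Section Powers.
Context {R : realType} {A : comBanachAlgType R}.
Variable sigma : algebra_aut A.
Implicit Types (n m : int) (a b : A) (phi : character_space A).

Lemma aut_pow_add m n a :
  aut_pow sigma (m + n) a = aut_pow sigma m (aut_pow sigma n a).
Proof. exact: (iterzD (aut_funK sigma) (aut_invK sigma)). Qed.

Lemma aut_pow_linear n : linear (aut_pow sigma n).
Proof.
move=> c a b; elim/int_rect: n => [//|n IH|n IH].
  rewrite -addn1 PoszD /aut_pow !(iterzS (aut_invK sigma)).
  by rewrite -/(aut_pow sigma n _) IH aut_linear.
rewrite -addn1 PoszD opprD /aut_pow !(iterzB1 (aut_funK sigma) (aut_invK sigma)).
by rewrite -/(aut_pow sigma _ _) IH aut_inv_linear.
Qed.

Lemma aut_powD n : {morph aut_pow sigma n : a b / a + b}.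
Proof.
by move=> a b; have := aut_pow_linear n 1 a b; rewrite !scale1r.
Qed.

Lemma aut_pow_0 n : aut_pow sigma n 0 = 0.
Proof. by apply: (addIr (aut_pow sigma n 0)); rewrite -aut_powD !add0r. Qed.

Lemma aut_powB n a b :
  aut_pow sigma n (a - b) = aut_pow sigma n a - aut_pow sigma n b.
Proof.
by rewrite addrC -scaleN1r aut_pow_linear scaleN1r addrC.
Qed.

Lemma aut_powVK n : cancel (aut_pow sigma n) (aut_pow sigma (- n)).
Proof. by move=> a; rewrite -aut_pow_add addNr. Qed.

Lemma aut_powKV n : cancel (aut_pow sigma (- n)) (aut_pow sigma n).
Proof. by move=> a; rewrite -aut_pow_add addrN. Qed.

Lemma character_induced_pow n phi a :
  character_fun (induced_pow sigma n phi) a =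
  character_fun phi (aut_pow sigma (- n) a).
Proof.
have fK := @induced_mapK _ _ sigma; have gK := @induced_mapVK _ _ sigma.
elim/int_rect: n a => [//|n IH|n IH] a.
  rewrite -addn1 PoszD /induced_pow (iterzS gK) -/(induced_pow sigma n phi).
  by rewrite mk_characterE /= IH opprD aut_pow_add.
rewrite -addn1 PoszD opprD /induced_pow (iterzB1 fK gK).
rewrite -/(induced_pow sigma _ phi) mk_characterE /= IH.
by rewrite opprD opprK aut_pow_add opprK.
Qed.

Definition fixed_points n : set (character_space A) :=
  [set phi | induced_pow sigma n phi = phi].

Lemma fixed_pointsP n phi :
  fixed_points n phi <->
  forall a, character_fun phi (aut_pow sigma n a) = character_fun phi a.
Proof.
split=> [fix_phi a|fix_phi].
  by rewrite -{1}fix_phi character_induced_pow aut_powVK.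
apply: character_fun_inj; apply/funext => a.
by rewrite character_induced_pow -fix_phi aut_powKV.
Qed.

(** Powers of the induced map commute, so they preserve each set of fixed
    points: this is what keeps [telescoping_ideal] stable under left
    multiplication. *)
Lemma fixed_points_invariant n m phi :
  fixed_points n (induced_pow sigma m phi) -> fixed_points n phi.
Proof.
move=> /fixed_pointsP fix_phi; apply/fixed_pointsP => a.
have := fix_phi (aut_pow sigma m a).
by rewrite !character_induced_pow -!aut_pow_add addrAC addNr add0r.
Qed.

Lemma fixed_pointsN n phi : fixed_points (- n) phi <-> fixed_points n phi.
Proof.
split=> /fixed_pointsP fix_phi; apply/fixed_pointsP => a.
  by rewrite -fix_phi aut_powVK.
by rewrite -fix_phi aut_powKV.
Qed.

End Powers.

(** * The crossed product *)

Section Coefficients.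
Context {R : realType} {A : comBanachAlgType R}.
Variable sigma : algebra_aut A.
Implicit Types (f g : crossed_product sigma) (a b : A) (k m n : int).

Lemma cp_coeff_eq0 f k : (cp_coeff k f == 0) = (k \notin cp_support f).
Proof. exact: mcoeff_eq0. Qed.

Lemma cp_coeffB k f g : cp_coeff k (f - g) = cp_coeff k f - cp_coeff k g.
Proof. exact: mcoeffB. Qed.

Lemma cp_coeff0 k : cp_coeff k (0 : crossed_product sigma) = 0.
Proof. exact: mcoeff0. Qed.

Lemma cp_coeff_monomial k n a :
  cp_coeff k (cp_monomial sigma n a) = a *+ (n == k).
Proof. exact: mcoeffU. Qed.

(** The hypothesis on [F] covers an index [j] outside the support, where
    every term of the sum is [0]. *)
Lemma sum_support_delta f (F : int -> A) j : (cp_coeff j f = 0 -> F j = 0) ->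
  \sum_(m <- cp_support f) F m *+ (m == j) = F j.
Proof.
move=> F0; have [jf|jf] := boolP (j \in cp_support f).
  rewrite (big_rem j) //= eqxx mulr1n big1_seq ?addr0 // => m /= mf.
  by case: eqVneq mf => // ->; rewrite mem_rem_uniqF ?fset_uniq.
rewrite F0; last by apply/eqP; rewrite cp_coeff_eq0.
rewrite big1_seq // => m /= mf.
by case: eqVneq mf jf => // -> ->.
Qed.

(** The product has two coefficient formulas, summing over the support of
    either factor; both are used so that one factor can be varied without its
    support appearing as a range of summation. *)
Lemma cp_coeff_mul_suppl k f g : cp_coeff k (cp_mul f g) =
  \sum_(n <- cp_support f)
    bmul (cp_coeff n f) (aut_pow sigma n (cp_coeff (k - n) g)).
Proof.
rewrite /cp_mul (big_morph _ (cp_coeffD k) (cp_coeff0 k)).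
apply: eq_bigr => n _; rewrite (big_morph _ (cp_coeffD k) (cp_coeff0 k)).
rewrite -[RHS](@sum_support_delta g (fun m =>
  bmul (cp_coeff n f) (aut_pow sigma n (cp_coeff m g)))).
  apply: eq_bigr => m _; rewrite cp_coeff_monomial.
  by rewrite -(inj_eq (addrI n) m (k - n)) addrCA addrN addr0.
by move=> ->; rewrite aut_pow_0 bmul0r.
Qed.

Lemma cp_coeff_mul_suppr k f g : cp_coeff k (cp_mul f g) =
  \sum_(m <- cp_support g)
    bmul (cp_coeff (k - m) f) (aut_pow sigma (k - m) (cp_coeff m g)).
Proof.
rewrite /cp_mul exchange_big (big_morph _ (cp_coeffD k) (cp_coeff0 k)).
apply: eq_bigr => m _; rewrite (big_morph _ (cp_coeffD k) (cp_coeff0 k)).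
rewrite -[RHS](@sum_support_delta f (fun n =>
  bmul (cp_coeff n f) (aut_pow sigma n (cp_coeff m g)))).
  apply: eq_bigr => n _; rewrite cp_coeff_monomial.
  by rewrite -(inj_eq (addIr m) n (k - m)) subrK.
by move=> ->; rewrite bmul0l.
Qed.

Lemma cp_coeff_monomial_mul k m b f :
  cp_coeff k (cp_mul (cp_monomial sigma m b) f) =
  bmul b (aut_pow sigma m (cp_coeff (k - m) f)).
Proof.
rewrite cp_coeff_mul_suppl -[RHS](@sum_support_delta (cp_monomial sigma m b)
  (fun n => bmul b (aut_pow sigma n (cp_coeff (k - n) f)))).
  apply: eq_bigr => n _; rewrite cp_coeff_monomial eq_sym.
  by case: eqVneq => // _; rewrite bmul0l.
by rewrite cp_coeff_monomial eqxx mulr1n => ->; rewrite bmul0l.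
Qed.

Lemma cp_coeff_mul_monomial k m b f :
  cp_coeff k (cp_mul f (cp_monomial sigma m b)) =
  bmul (cp_coeff (k - m) f) (aut_pow sigma (k - m) b).
Proof.
rewrite cp_coeff_mul_suppr -[RHS](@sum_support_delta (cp_monomial sigma m b)
  (fun n => bmul (cp_coeff (k - n) f) (aut_pow sigma (k - n) b))).
  apply: eq_bigr => n _; rewrite cp_coeff_monomial eq_sym.
  by case: eqVneq => // _; rewrite aut_pow_0 bmul0r.
by rewrite cp_coeff_monomial eqxx mulr1n => ->; rewrite aut_pow_0 bmul0r.
Qed.

Lemma cp_baseP f : cp_base sigma f <-> forall k, k != 0 -> cp_coeff k f = 0.
Proof.
split=> [[a _ <-] k k0|f0]; first by rewrite cp_coeff_monomial eq_sym (negPf k0).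
exists (cp_coeff 0 f) => //; apply: cp_eqP => k.
by rewrite cp_coeff_monomial; case: eqVneq => [->|] //; rewrite eq_sym => /f0 ->.
Qed.

Lemma cp_base_abelian : abelian_subalgebra (cp_base sigma).
Proof.
split; first split.
- by apply/cp_baseP => k _; rewrite cp_coeff0.
- move=> x y /cp_baseP x0 /cp_baseP y0; apply/cp_baseP => k k0.
  by rewrite cp_coeffD x0 // y0 // addr0.
- move=> c x /cp_baseP x0; apply/cp_baseP => k k0.
  by rewrite [LHS]cp_coeff_scale x0 // scaler0.
- move=> _ _ [a _ <-] [b _ <-]; rewrite cp_mul_monomial addr0.
  by exists (bmul a b).
- move=> _ _ [a _ <-] [b _ <-]; rewrite !cp_mul_monomial.
  by rewrite bmulC.
Qed.

End Coefficients.

Section Equivalences.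
Context {R : realType} {A : comBanachAlgType R}.
Variable sigma : algebra_aut A.
Implicit Types (f g h : crossed_product sigma) (a b : A) (k m n : int).
Implicit Types (phi : character_space A).

Definition characters_separate :=
  forall a, (forall phi, character_fun phi a = 0) -> a = 0.

Definition vanishes_off (S : set (character_space A)) a :=
  forall phi, ~ S phi -> character_fun phi a = 0.

(** When characters separate points and [A] is completely regular, this says
    that the sets of periodic points of a given period have empty
    interior. *)
Definition fixed_points_support_nothing :=
  forall n, n != 0 -> forall a, vanishes_off (fixed_points sigma n) a -> a = 0.

Lemma vanishes_off_sum (S : set (character_space A)) (I : Type) (r : seq I)
    (F : I -> A) :
  (forall i, vanishes_off S (F i)) -> vanishes_off S (\sum_(i <- r) F i).
Proof.
by move=> vanF phi Sphi; rewrite character_sum big1 // => i _; exact: vanF.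
Qed.

Hypothesis sep : characters_separate.

(** Pointwise on characters, [phi a * (phi (sigma^n b) - phi b)] is zero for
    all [b] iff [phi a = 0] or [phi] is fixed. *)
Lemma vanishes_off_fixedP n a : vanishes_off (fixed_points sigma n) a <->
  forall b, bmul a (aut_pow sigma n b) = bmul a b.
Proof.
split=> [a_van c|a_comm phi nfix].
  apply/eqP; rewrite -subr_eq0 -bmulBr; apply/eqP/sep => phi.
  rewrite characterM; have [/fixed_pointsP fix_phi|nfix] :=
    pselect (fixed_points sigma n phi).
    by rewrite characterB fix_phi subrr mulr0.
  by rewrite a_van // mul0r.
apply/eqP/negPn/negP => a0; apply: nfix; apply/fixed_pointsP => c.
by apply: (mulfI a0); rewrite -!characterM a_comm.
Qed.

(** The commutant of [A], described by its coefficients; see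
    [base_commutantP]. *)
Definition base_commutant : set (crossed_product sigma) :=
  [set f | forall k, vanishes_off (fixed_points sigma k) (cp_coeff k f)].

Lemma base_commutantP f : base_commutant f <->
  forall b, cp_mul f (cp_monomial sigma 0 b) = cp_mul (cp_monomial sigma 0 b) f.
Proof.
split=> [fix_f b|f_comm k].
  apply: cp_eqP => k; rewrite cp_coeff_mul_monomial cp_coeff_monomial_mul subr0.
  by rewrite (vanishes_off_fixedP k _).1 // bmulC.
apply/vanishes_off_fixedP => b; have := congr1 (cp_coeff k) (f_comm b).
by rewrite cp_coeff_mul_monomial cp_coeff_monomial_mul subr0 [bmul b _]bmulC.
Qed.

(** On the supports involved the automorphism acts trivially, so that elements
    of the commutant multiply as in the group algebra [A[Z]]; this is why the
    commutant is abelian. *)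
Lemma base_commutant_mul f g k : base_commutant f ->
  cp_coeff k (cp_mul f g) =
  \sum_(n <- cp_support f) bmul (cp_coeff n f) (cp_coeff (k - n) g).
Proof.
move=> fix_f; rewrite cp_coeff_mul_suppl; apply: eq_bigr => n _.
exact: (vanishes_off_fixedP n _).1.
Qed.

Lemma base_commutant_abelian : abelian_subalgebra base_commutant.
Proof.
split; first split.
- by move=> k phi _; rewrite cp_coeff0 character0.
- by move=> x y fx fy k phi nfix; rewrite cp_coeffD characterD fx ?fy ?addr0.
- by move=> c x fx k phi nfix; rewrite cp_coeff_scale characterZ fx ?mulr0.
- move=> f g fix_f fix_g k; rewrite base_commutant_mul //.
  apply: vanishes_off_sum => n phi nfix; rewrite characterM.
  have [fixn|nfixn] := pselect (fixed_points sigma n phi); last first.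
    by rewrite fix_f // mul0r.
  rewrite fix_g ?mulr0 // => fixkn; apply: nfix; apply/fixed_pointsP => a.
  rewrite -(subrK n k) aut_pow_add.
  by move/fixed_pointsP: fixkn => ->; move/fixed_pointsP: fixn.
- move=> f g fix_f fix_g; apply: cp_eqP => k.
  rewrite base_commutant_mul // cp_coeff_mul_suppr; apply: eq_bigr => n _.
  by rewrite bmulC (vanishes_off_fixedP (k - n) _).1.
Qed.

(** The commutant is an abelian subalgebra containing [A] and every abelian
    subalgebra containing [A] lies in it, so [A] is maximal abelian iff the
    commutant is [A]. *)
Lemma fixed_points_support_nothing_max_abelian :
  fixed_points_support_nothing <-> maximal_abelian_subalgebra (cp_base sigma).
Proof.
split=> [P|[_ maxA] n n0 a a_van].
  split; first exact: cp_base_abelian.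
  move=> B [_ _ Bcomm] AB; apply/seteqP; split=> // f Bf.
  apply/cp_baseP => k k0; apply: (P k k0); move: k {k0}.
  apply/base_commutantP => b.
  by apply: Bcomm => //; apply: AB; exists b.
have AC : cp_base sigma `<=` base_commutant.
  move=> _ [b _ <-] k phi nfix; rewrite cp_coeff_monomial.
  case: eqVneq nfix => [<-|_ _]; last by rewrite character0.
  by case; apply/fixed_pointsP.
have : base_commutant (cp_monomial sigma n a).
  move=> k; rewrite cp_coeff_monomial; case: eqVneq => [<- //|_] phi _.
  exact: character0.
rewrite (maxA _ base_commutant_abelian AC) => /cp_baseP /(_ n n0).
by rewrite cp_coeff_monomial eqxx.
Qed.

Lemma minimal_support_element (I : set (crossed_product sigma)) f :
  I f -> f <> 0 ->
  exists g, [/\ I g, g <> 0 & forall h, I h -> h <> 0 ->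
    (size (cp_support g) <= size (cp_support h))%N].
Proof.
move=> If f0; pose P s := `[< exists g, [/\ I g, g <> 0 &
  size (cp_support g) = s] >].
have exP : exists s, P s.
  by exists (size (cp_support f)); apply/asboolP; exists f.
case: (ex_minnP exP) => s /asboolP[g [Ig g0 <-]] min_s; exists g; split=> //.
by move=> h Ih h0; apply: min_s; apply/asboolP; exists h.
Qed.

(** An element of least support in [I], translated to have a non-zero
    coefficient at [0], commutes with [A]: its commutators with [A] lie in [I]
    and lose the index [0] from their support.  Hence it lies in [A]. *)
Lemma fixed_points_support_nothing_ideals :
  fixed_points_support_nothing -> nonzero_ideals_meet_base sigma.
Proof.
move=> P I [[I0 ID IZ] Imul] In0 IA.
have [f [If f0 fmin]] : exists f, [/\ I f, f <> 0 & forall h, I h -> h <> 0 ->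
    (size (cp_support f) <= size (cp_support h))%N].
  have [f [If f0]] : exists f, I f /\ f <> 0.
    apply: contrapT => noI; apply: In0; apply/seteqP; split=> [f If|f -> //].
    by apply: contrapT => f0; apply: noI; exists f.
  exact: (minimal_support_element If f0).
have [k fk] : exists k, cp_coeff k f != 0.
  apply: contrapT => noK; apply: f0; apply: cp_eqP => k; rewrite cp_coeff0.
  by apply/eqP/negPn/negP => fk; apply: noK; exists k.
(* [b] is chosen so that the coefficient at [0] of [f * b delta^(-k)] is the
   square of [f_k], which is non-zero since characters separate points. *)
pose b := aut_pow sigma (- k) (cp_coeff k f).
pose g := cp_mul f (cp_monomial sigma (- k) b).
have Ig : I g by exact: (Imul _ _ If).2.
have gE n : cp_coeff n g = bmul (cp_coeff (n + k) f) (aut_pow sigma (n + k) b).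
  by rewrite cp_coeff_mul_monomial opprK.
have g00 : cp_coeff 0 g != 0.
  rewrite gE add0r aut_powKV; apply/eqP => ff0.
  move/eqP: fk; apply; apply: sep => phi; apply/eqP.
  by rewrite -[_ == 0]orbb -mulf_eq0 -characterM ff0 character0.
have g0 : g <> 0 by move=> g0; rewrite g0 cp_coeff0 eqxx in g00.
have fg : (size (cp_support g) <= size (cp_support f))%N.
  rewrite -(size_map (+%R^~ k)); apply: uniq_leq_size.
    by rewrite map_inj_uniq ?fset_uniq //; exact: addIr.
  move=> _ /mapP[n ng ->]; apply: contraLR ng.
  rewrite -!cp_coeff_eq0 gE => /eqP->.
  by rewrite bmul0l.
have gcomm : base_commutant g.
  apply/base_commutantP => c; apply/eqP; rewrite -subr_eq0; apply/negPn/negP.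
  set h := _ - _ => /eqP h0.
  have Ih : I h.
    apply: ID; first exact: (Imul _ _ Ig).2.
    by rewrite -scaleN1r; apply: IZ; exact: (Imul _ _ Ig).1.
  have hE n : cp_coeff n h =
      bmul (cp_coeff n g) (aut_pow sigma n c) - bmul c (cp_coeff n g).
    by rewrite cp_coeffB cp_coeff_mul_monomial cp_coeff_monomial_mul subr0.
  have : (size (cp_support h) < size (cp_support g))%N.
    apply: (@uniq_leq_size _ (0 :: cp_support h)) => [|n].
      rewrite /= fset_uniq andbT -cp_coeff_eq0 hE bmulC subrr //.
    rewrite inE => /orP[/eqP->|].
      by rewrite -[_ \in _]negbK -cp_coeff_eq0.
    apply: contraLR; rewrite -!cp_coeff_eq0 hE => /eqP->.
    by rewrite bmul0l bmul0r subrr.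
  by rewrite ltnNge (leq_trans fg) // fmin.
have gA : cp_base sigma g by apply/cp_baseP => n n0; exact: (P n n0).
by apply: g0; have : (I `&` cp_base sigma) g by []; rewrite IA.
Qed.

(** The elements [g - g delta^n], where the coefficients of [g] vanish off the
    fixed points of the [n]-th power.  The relation [f_k = g_k - g_(k-n)]
    expresses the shift by [n] without constructing [g delta^n], which is not a
    product when [A] has no unit. *)
Definition telescoping_ideal n : set (crossed_product sigma) :=
  [set f | exists g,
    (forall k, vanishes_off (fixed_points sigma n) (cp_coeff k g)) /\
    forall k, cp_coeff k f = cp_coeff k g - cp_coeff (k - n) g].

Lemma telescoping_idealP n : two_sided_ideal (telescoping_ideal n).
Proof.
split; first split.
- exists 0; split=> k; first by move=> phi _; rewrite cp_coeff0 character0.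
  by rewrite !cp_coeff0 subrr.
- move=> x y [g [gv xg]] [h [hv yh]]; exists (g + h); split=> k.
    by move=> phi nfix; rewrite cp_coeffD characterD gv ?hv ?addr0.
  by rewrite !cp_coeffD xg yh opprD addrACA.
- move=> c x [g [gv xg]]; exists (c *: g); split=> k.
    by move=> phi nfix; rewrite [cp_coeff k _]cp_coeff_scale characterZ gv ?mulr0.
  by rewrite ![cp_coeff _ (c *: _)]cp_coeff_scale xg scalerBr.
move=> f x [g [gv xg]]; split.
  exists (cp_mul f g); split=> k.
    rewrite cp_coeff_mul_suppl; apply: vanishes_off_sum => m phi nfix.
    rewrite characterM -[m]opprK -character_induced_pow gv ?mulr0 //.
    by move/fixed_points_invariant.
  rewrite !cp_coeff_mul_suppl -sumrB; apply: eq_bigr => m _.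
  by rewrite -bmulBr -aut_powB xg addrAC.
(* On the right the shift changes [sigma^m] into [sigma^(m+n)]; both agree
   against coefficients of [g]. *)
exists (cp_mul g f); split=> k.
  rewrite cp_coeff_mul_suppr; apply: vanishes_off_sum => m phi nfix.
  by rewrite characterM gv ?mul0r.
rewrite !cp_coeff_mul_suppr -sumrB; apply: eq_bigr => m _.
rewrite xg bmulBl; congr (_ - _); rewrite (addrAC k (- n)).
rewrite -{2}(subrKC n (k - m)) aut_pow_add.
by rewrite (vanishes_off_fixedP n _).1.
Qed.

(** If the difference of [g] and its shift lies in [A], then [g] is constant
    along the arithmetic progression of step [n] through [0] going up, and
    along the one through [-n] going down; finite support makes both constants
    [0], so that the difference is [0]. *)
Lemma ideals_fixed_points_support_nothing :
  nonzero_ideals_meet_base sigma -> fixed_points_support_nothing.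
Proof.
move=> meetA n n0 a a_van; apply: contrapT => a0.
apply: (meetA _ (telescoping_idealP n)).
  pose f := cp_monomial sigma 0 a - cp_monomial sigma n a.
  have If : telescoping_ideal n f.
    exists (cp_monomial sigma 0 a); split=> k.
      rewrite cp_coeff_monomial; case: eqP => [_|_ phi _]; [|exact: character0].
      exact: a_van.
    rewrite cp_coeffB !cp_coeff_monomial (eq_sym 0 (k - n)) subr_eq0.
    by rewrite (eq_sym n k).
  move=> I0; rewrite I0 in If; have := congr1 (cp_coeff 0) If.
  by rewrite cp_coeffB !cp_coeff_monomial eqxx (negPf n0) subr0 cp_coeff0.
apply/seteqP; split=> [_ [] /[swap] [[b _ <-]] [g [_ bg]]|_ ->]; last first.
  by have [[I0 _ _] _] := telescoping_idealP n; split=> //; apply/cp_baseP => k _;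
    rewrite cp_coeff0.
have gS k : k != 0 -> cp_coeff (k - n) g = cp_coeff k g.
  move=> k0; apply/esym/eqP; rewrite -subr_eq0 -bg cp_coeff_monomial.
  by rewrite (eq_sym 0) (negPf k0).
(* Beyond [B] there is no support. *)
pose B := (\sum_(k <- cp_support g) `|k|)%N.+1.
have out k : (B <= `|k|)%N -> cp_coeff k g = 0.
  move=> Bk; apply/eqP; rewrite cp_coeff_eq0; apply/negP => kg.
  by move: Bk; rewrite /B (big_rem k) //= ltnNge leq_addr.
have up j : cp_coeff (j%:Z * n) g = cp_coeff 0 g.
  elim: j => [|j <-]; first by rewrite mul0r.
  by rewrite -gS ?mulf_neq0 // -{2}[n]mul1r -mulrBl -addn1 PoszD addrK.
have down j : cp_coeff (- j%:Z * n - n) g = cp_coeff (- n) g.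
  elim: j => [|j <-]; first by rewrite oppr0 mul0r sub0r.
  rewrite gS; last by rewrite mulf_neq0 // oppr_eq0.
  by rewrite -addn1 PoszD opprD mulrDl mulN1r.
have gn : cp_coeff 0 g = 0.
  rewrite -(up B); apply: out; rewrite abszM absz_nat.
  by rewrite leq_pmulr // absz_gt0.
have gNn : cp_coeff (- n) g = 0.
  rewrite -(down B); apply: out.
  have -> : - B%:Z * n - n = - (B.+1%:Z * n).
    by rewrite -addn1 PoszD mulrDl mul1r opprD mulNr.
  by rewrite abszN abszM absz_nat (leq_trans (leqnSn B)) // leq_pmulr // absz_gt0.
have := bg 0; rewrite cp_coeff_monomial eqxx mulr1n sub0r gn gNn subrr => ->.
by apply: cp_eqP => k; rewrite cp_coeff_monomial cp_coeff0 mul0rn.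
Qed.

End Equivalences.

(** * Real-valued norms and compactness of complex discs *)

Section RealNorm.
Context {R : realType} {V : normedModType R[i]}.
Implicit Types (v w : V) (c : R[i]).

(** The norm of [V] is valued in [R[i]]; order arguments and the extreme value
    theorem need it in [R]. *)
Definition rnorm v : R := complex.Re `|v|.

Lemma rnormE v : `|v| = (rnorm v)%:C%C.
Proof. by rewrite /rnorm RRe_real ?normr_real. Qed.

Lemma rnorm_ge0 v : 0 <= rnorm v.
Proof. by rewrite -ler0c -rnormE. Qed.

Lemma rnorm0 : rnorm 0 = 0.
Proof. by apply: complexI; rewrite -rnormE normr0. Qed.

Lemma rnorm_eq0 v : (rnorm v == 0) = (v == 0).
Proof. by rewrite -[RHS]normr_eq0 rnormE (inj_eq (@complexI R) _ 0). Qed.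

Lemma rnormN v : rnorm (- v) = rnorm v.
Proof. by rewrite /rnorm normrN. Qed.

Lemma rdistC v w : rnorm (v - w) = rnorm (w - v).
Proof. by rewrite -rnormN opprB. Qed.

Lemma rnormD v w : rnorm (v + w) <= rnorm v + rnorm w.
Proof. by rewrite -lecR rmorphD /= -!rnormE ler_normD. Qed.

Lemma rnorm_cvgP {T} {F : set_system T} {FF : Filter F} (f : T -> V) v :
  f @ F --> v <-> forall e : R, 0 < e -> \forall t \near F, rnorm (v - f t) < e.
Proof.
split=> [/cvgrPdist_lt fv e e0|fv].
  have /fv : 0 < e%:C%C by rewrite ltcR.
  by apply: filterS => t; rewrite rnormE ltcR.
apply/cvgrPdist_lt => e e0.
have eE : e = (complex.Re e)%:C%C by rewrite RRe_real // gtr0_real.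
rewrite eE ltcR in e0; move: (fv _ e0); apply: filterS => t.
by rewrite eE rnormE ltcR.
Qed.

Lemma rnorm_continuous : continuous rnorm.
Proof.
move=> v; apply/cvgrPdist_lt => e e0.
have /rnorm_cvgP /(_ e e0) : (fun w => w) @ nbhs v --> v by exact: cvg_id.
have H (x y : V) : rnorm x <= rnorm y + rnorm (x - y).
  by rewrite -{1}(subrKC y x) rnormD.
by apply: filterS => w; apply: le_lt_trans; rewrite ler_distl lerBlDr H rdistC H.
Qed.

Lemma rnorm_cvg {T} {F : set_system T} {FF : Filter F} (f : T -> V) v :
  f @ F --> v -> rnorm (f t) @[t --> F] --> rnorm v.
Proof.
move=> fv; apply: (@cvg_comp _ _ _ f rnorm _ _ _ fv); exact: rnorm_continuous.
Qed.

End RealNorm.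

Lemma rnormZ {R : realType} {V : normedModType R[i]} (c : R[i]^o) (v : V) :
  rnorm (c *: v) = rnorm c * rnorm v.
Proof. by apply: complexI; rewrite rmorphM /= -!rnormE normrZ. Qed.

Lemma rnormM {R : realType} (c d : R[i]^o) : rnorm (c * d) = rnorm c * rnorm d.
Proof. exact: (rnormZ c (d : R[i]^o)). Qed.

Lemma rnorm_real {R : realType} (x : R) : rnorm (x%:C%C : R[i]^o) = `|x|.
Proof. by apply: complexI; rewrite -rnormE normc_def /= expr0n addr0 sqrtr_sqr. Qed.

Lemma rnorm_bmul {R : realType} {A : comBanachAlgType R} (a b : A) :
  rnorm (bmul a b) <= rnorm a * rnorm b.
Proof. by rewrite -lecR rmorphM /= -!rnormE ler_norm_bmul. Qed.

Section ComplexDisc.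
Context {R : realType}.

Lemma Complex_continuous :
  continuous (fun p : R * R => (Complex p.1 p.2 : R[i]^o)).
Proof.
move=> p; apply/rnorm_cvgP => e e0; near=> q.
have -> : Complex p.1 p.2 - Complex q.1 q.2 =
    (p.1 - q.1)%:C%C + 'i%C * (p.2 - q.2)%:C%C :> R[i]^o.
  by rewrite -(complexE (Complex _ _)).
apply: le_lt_trans (rnormD _ _) _; rewrite rnormM !rnorm_real.
have -> : rnorm ('i%C : R[i]^o) = 1.
  by apply: complexI; rewrite -rnormE normc_def /= expr0n expr1n add0r sqrtr1.
rewrite mul1r [X in _ < X](splitr e) ltrD //.
  near: q; apply: (@cvgr_dist_lt _ _ _ (nbhs p) _ (fun q => q.1) p.1).
    exact: cvg_fst.
  by rewrite divr_gt0.
near: q; apply: (@cvgr_dist_lt _ _ _ (nbhs p) _ (fun q => q.2) p.2).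
  exact: cvg_snd.
by rewrite divr_gt0.
Unshelve. all: by end_near. Qed.

Lemma disc_compact (r : R) : compact [set z : R[i]^o | rnorm z <= r].
Proof.
pose S := `[- r, r] `*` `[- r, r].
have cS : compact S by apply: compact_setX; exact: segment_compact.
apply: subclosed_compact
  (continuous_compact (continuous_subspaceT Complex_continuous) cS) _.
  by apply: (closed_comp _ (@closed_le R r)) => z _; exact: rnorm_continuous.
move=> z /= zr; exists (complex.Re z, complex.Im z); last by case: z {zr}.
have Rez : `|complex.Re z| <= r.
  by apply: le_trans zr; rewrite -lecR -rnormE normc_ge_Re.
have Imz : `|complex.Im z| <= r.
  apply: le_trans zr; rewrite -lecR -rnormE normc_def lecR -sqrtr_sqr.
  by rewrite ler_wsqrtr // lerDr sqr_ge0.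
by split; rewrite /= in_itv /= -ler_norml.
Qed.

End ComplexDisc.

Section QuasiInverse.
Context {R : realType} {A : comBanachAlgType R}.

(** [b] is the Neumann series [v + v^2 + ...]: the partial sums are iterates of
    the contraction [y |-> v + v y]. *)
Lemma quasi_inverse (v : A) : rnorm v < 1 -> exists b, b = v + bmul v b.
Proof.
set t := rnorm v => t1; have t0 : 0 <= t by exact: rnorm_ge0.
have t1' : 0 < 1 - t by rewrite subr_gt0.
pose s n := iter n (fun y => v + bmul v y) 0.
pose C := t / (1 - t).
have sC m : rnorm (s m) <= C.
  elim: m => [|m IH]; first by rewrite rnorm0 divr_ge0 // ltW.
  apply: le_trans (rnormD _ _) _; apply: le_trans (lerD (lexx _) (rnorm_bmul _ _)) _.
  apply: le_trans (lerD (lexx _) (ler_wpM2l t0 IH)) _.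
  rewrite -/t /C -[X in X + _](mulfK (lt0r_neq0 t1')) mulrA -mulrDl.
  by rewrite mulrBr mulr1 subrK.
have s_dist n m : rnorm (s (n + m)%N - s n) <= t ^+ n * C.
  elim: n => [|n IH]; first by rewrite expr0 mul1r subr0.
  rewrite /s addSn !iterS opprD addrACA subrr add0r -bmulBr exprS -mulrA.
  by apply: le_trans (rnorm_bmul _ _) _; rewrite ler_wpM2l.
have tC0 : (fun n => t ^+ n * C) @ \oo --> 0.
  rewrite -(mul0r C); apply: cvgMl; apply: cvg_expr.
  by rewrite ger0_norm.
have s_small (e : R) : 0 < e -> exists n, forall m, rnorm (s (n + m)%N - s n) < e.
  move=> e0; move/cvgrPdist_lt: tC0 => /(_ e e0) [n _ /(_ n (leqnn n))].
  rewrite /= sub0r normrN => tne; exists n => m; apply: le_lt_trans (s_dist n m) _.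
  by apply: le_lt_trans tne; exact: ler_norm.
have : cvg (s @ \oo).
  apply/cauchy_cvgP; apply: cauchy_exP => e e0.
  have eE : e = (complex.Re e)%:C%C by rewrite RRe_real // gtr0_real.
  have [|n sn] := s_small (complex.Re e); first by rewrite eE ltcR in e0.
  exists (s n); exists n => // m /= nm; rewrite -ball_normE /= eE rnormE ltcR.
  by rewrite rdistC -(subnKC nm).
move=> /cvg_ex[b sb]; exists b; apply/eqP; rewrite -subr_eq0 -rnorm_eq0.
rewrite eq_le rnorm_ge0 andbT; apply/ler_addgt0Pl => e e0; rewrite addr0.
move/rnorm_cvgP: sb => /(_ (e / 2)) [|n _ sn]; first by rewrite divr_gt0.
have -> : b - (v + bmul v b) = (b - s n.+1) + bmul v (s n - b).
  by rewrite bmulBr /s iterS addrA !opprD !addrA addrNK.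
apply: le_trans (rnormD _ _) _; rewrite (splitr e) lerD //.
  by rewrite ltW // sn //= leqW.
apply: le_trans (rnorm_bmul _ _) _; rewrite -[X in _ <= X]mul1r ler_pM ?rnorm_ge0 //.
  exact: ltW.
by rewrite rdistC ltW // sn //=.
Qed.

(** If [|phi a| > |a|], then [v = a / phi a] has norm less than [1], and [phi]
    turns [b = v + v b] into [phi b = 1 + phi b]. *)
Lemma character_le_norm (phi : character_space A) a :
  rnorm (character_fun phi a : R[i]^o) <= rnorm a.
Proof.
rewrite leNgt; apply/negP => ltphi.
pose z : R[i]^o := character_fun phi a.
have z0 : z != 0 by rewrite -rnorm_eq0 gt_eqF // (le_lt_trans (rnorm_ge0 a)).
have nz : 0 < rnorm z by rewrite lt_neqAle eq_sym rnorm_eq0 z0 rnorm_ge0.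
have [|b bE] := @quasi_inverse (z^-1 *: a).
  have zV : rnorm (z^-1 : R[i]^o) = (rnorm z)^-1.
    apply: (mulIf (lt0r_neq0 nz)); rewrite mulVf ?lt0r_neq0 //.
    by rewrite -rnormM mulVf // (rnorm_real 1) normr1.
  by rewrite (rnormZ (z^-1)) zV mulrC ltr_pdivrMr // mul1r.
have := congr1 (character_fun phi) bE.
rewrite characterD characterM characterZ -/z mulVf // mul1r => /eqP.
by rewrite -subr_eq subrr eq_sym oner_eq0.
Qed.

End QuasiInverse.

(** * The Gelfand-Mazur theorem for maximal modular ideals *)

Section MaximalModularIdeal.
Context {R : realType} {A : comBanachAlgType R}.
Context (M : set A) (Mmax : maximal_modular_ideal M).
Context (u : A) (Mu : forall a, M (bmul a u - a)).
Implicit Types (a b x y : A) (c : R[i]).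

Let MI : is_ideal M. Proof. by case: Mmax. Qed.
Let M0 : M 0. Proof. by case: MI => -[]. Qed.
Let MD x y : M x -> M y -> M (x + y). Proof. by case: MI => -[_ + _] _; exact. Qed.
Let MZ c x : M x -> M (c *: x). Proof. by case: MI => -[_ _ +] _; exact. Qed.
Let MM a x : M x -> M (bmul a x). Proof. by case: MI => _; exact. Qed.
Let MMr a x : M x -> M (bmul x a). Proof. by rewrite bmulC; exact: MM. Qed.
Let MN x : M x -> M (- x). Proof. by rewrite -scaleN1r; exact: MZ. Qed.

(** The quotient field [A / M] is handled through congruences, as [A] may lack
    a unit and quotients of rings do not apply. *)
Definition cong_mod x y := M (x - y).

Lemma cong_refl x : cong_mod x x. Proof. by rewrite /cong_mod subrr. Qed.

Lemma cong_sym x y : cong_mod x y -> cong_mod y x.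
Proof. by move=> /MN; rewrite opprB. Qed.

Lemma cong_trans y x z : cong_mod x y -> cong_mod y z -> cong_mod x z.
Proof. by move=> xy /(MD xy); rewrite addrA subrK. Qed.

Lemma congD x y x' y' :
  cong_mod x y -> cong_mod x' y' -> cong_mod (x + x') (y + y').
Proof. by move=> xy x'y'; rewrite /cong_mod opprD addrACA; exact: MD. Qed.

Lemma congZ c x y : cong_mod x y -> cong_mod (c *: x) (c *: y).
Proof. by move=> xy; rewrite /cong_mod -scalerBr; exact: MZ. Qed.

Lemma congB x y x' y' :
  cong_mod x y -> cong_mod x' y' -> cong_mod (x - x') (y - y').
Proof.
move=> xy x'y'; apply: congD => //.
by rewrite -(scaleN1r x') -(scaleN1r y'); exact: congZ.
Qed.

Lemma congM a x y : cong_mod x y -> cong_mod (bmul a x) (bmul a y).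
Proof. by move=> xy; rewrite /cong_mod -bmulBr; exact: MM. Qed.

Lemma unit_notin : ~ M u.
Proof.
move=> uM; case: Mmax => _ _ + _; apply; apply/seteqP; split=> // a _.
by rewrite -[a](subKr (bmul a u)); apply: MD; [exact: MM|exact: MN].
Qed.

(** The ideal [M + x A] strictly contains [M], as it contains [x u] and hence
    [x]; by maximality it contains [u]. *)
Lemma inverse_mod x : ~ M x -> exists y, cong_mod (bmul x y) u.
Proof.
move=> xM; pose I : set A := [set z | exists m, M m /\ exists y, z = m + bmul x y].
have [|] := pselect (I = setT).
  move=> IT; have : I u by rewrite IT.
  move=> [m [Mm [y uE]]]; exists y; apply: cong_sym.
  by rewrite /cong_mod uE addrK.
move=> InT; exfalso; apply: xM.
have IM : I = M.
  case: Mmax => _ _ _; apply => //; last first.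
    by move=> m Mm; exists m; split=> //; exists 0; rewrite bmul0r addr0.
  split; first split.
  - by exists 0; split=> //; exists 0; rewrite bmul0r addr0.
  - move=> _ _ [m [Mm [y ->]]] [n [Mn [z ->]]]; exists (m + n); split.
      exact: MD.
    by exists (y + z); rewrite bmulDr addrACA.
  - move=> c _ [m [Mm [y ->]]]; exists (c *: m); split; first exact: MZ.
    by exists (c *: y); rewrite scalerDr bmulZr.
  - move=> a _ [m [Mm [y ->]]]; exists (bmul a m); split; first exact: MM.
    by exists (bmul a y); rewrite bmulDr bmulCA.
rewrite -IM; exists (- (bmul x u - x)); split; first exact: MN.
by exists u; rewrite opprB subrK.
Qed.

(** The quotient seminorm of [A / M]. *)
Definition qnorm a : R := inf [set rnorm (a + m) | m in M].

Lemma qnorm_le a m : M m -> qnorm a <= rnorm (a + m).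
Proof.
move=> Mm; apply: ge_inf; last by exists m.
by exists 0 => _ [n _ <-]; exact: rnorm_ge0.
Qed.

Lemma le_qnorm t a : (forall m, M m -> t <= rnorm (a + m)) -> t <= qnorm a.
Proof.
move=> tle; apply: lb_le_inf; first by exists (rnorm (a + 0)); exists 0.
by move=> _ [m Mm <-]; exact: tle.
Qed.

Lemma qnorm_ge0 a : 0 <= qnorm a.
Proof. by apply: le_qnorm => m _; exact: rnorm_ge0. Qed.

Lemma le_Mqnorm t (c : R) a : 0 <= c ->
  (forall m, M m -> t <= c * rnorm (a + m)) -> t <= c * qnorm a.
Proof.
rewrite le_eqVlt => /predU1P[<-|c0] tle.
  by apply: le_trans (tle 0 M0) _; rewrite !mul0r.
rewrite mulrC -ler_pdivrMr //; apply: le_qnorm => m Mm.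
by rewrite ler_pdivrMr // mulrC tle.
Qed.

Lemma qnorm_cong a b : cong_mod a b -> qnorm a <= qnorm b.
Proof.
move=> ab; apply: le_qnorm => m Mm.
have -> : b + m = a + (m - (a - b)) by rewrite opprB addrCA subrKC addrC.
by apply: qnorm_le; apply: MD => //; exact: MN.
Qed.

Lemma qnormM a b : qnorm (bmul a b) <= qnorm a * qnorm b.
Proof.
rewrite mulrC; apply: le_Mqnorm => [|m Mm]; first exact: qnorm_ge0.
rewrite mulrC; apply: le_Mqnorm => [|n Mn]; first exact: rnorm_ge0.
apply: le_trans (rnorm_bmul _ _).
have -> : bmul (a + m) (b + n) = bmul a b + (bmul a n + bmul m (b + n)).
  by rewrite bmulDl [bmul a (b + n)]bmulDr addrA.
by apply: qnorm_le; apply: MD; [exact: MM|exact: MMr].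
Qed.

Lemma qnormD a b : qnorm (a + b) <= qnorm a + qnorm b.
Proof.
rewrite -lerBlDr; apply: le_qnorm => m Mm.
rewrite lerBlDl -lerBlDr; apply: le_qnorm => n Mn; rewrite lerBlDl.
by apply: le_trans (rnormD _ _); rewrite addrACA; apply: qnorm_le; exact: MD.
Qed.

Lemma qnormZ (c : R[i]^o) a : qnorm (c *: a) = rnorm c * qnorm a.
Proof.
apply/eqP; rewrite eq_le; apply/andP; split.
  apply: le_Mqnorm => [|m Mm]; first exact: rnorm_ge0.
  by rewrite -rnormZ scalerDr; apply: qnorm_le; exact: MZ.
have [->|c0] := eqVneq c 0; first by rewrite rnorm0 mul0r qnorm_ge0.
apply: le_qnorm => m Mm.
have -> : c *: a + m = c *: (a + c^-1 *: m).
  by rewrite scalerDr scalerA mulfV // scale1r.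
by rewrite rnormZ ler_wpM2l ?rnorm_ge0 // qnorm_le //; exact: MZ.
Qed.

Lemma qnormN a : qnorm (- a) = qnorm a.
Proof. by rewrite -scaleN1r (qnormZ (-1)) rnormN (rnorm_real 1) normr1 mul1r. Qed.

Lemma qnorm_sum (I : Type) (s : seq I) (F : I -> A) :
  qnorm (\sum_(i <- s) F i) <= \sum_(i <- s) qnorm (F i).
Proof.
elim: s => [|i s IH]; last first.
  by rewrite !big_cons; apply: le_trans (qnormD _ _) _; rewrite lerD2l.
rewrite !big_nil; apply: le_trans (qnorm_le 0 M0) _.
by rewrite addr0 rnorm0.
Qed.

(** An element [v = u + m] with [|v| < 1] would have a quasi-inverse
    [b = v + v b]; but [v] is again a unit modulo [M], so
    [v = b - v b] would lie in [M], and so would [u]. *)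
Lemma qnorm_unit : 1 <= qnorm u.
Proof.
apply: le_qnorm => m Mm; rewrite leNgt; apply/negP => /quasi_inverse[b bE].
apply: unit_notin; rewrite -(addrK m u); apply: MD; last exact: MN.
rewrite -[u + m](addrK (bmul (u + m) b)) -bE.
have -> : b - bmul (u + m) b = - (bmul b u - b) - bmul m b.
  by rewrite bmulDl opprB opprD addrA (bmulC u).
by apply: MD; apply: MN => //; exact: MMr.
Qed.

(** Here [r] is a resolvent of [x] modulo [M], assumed to exist on the whole
    plane; this leads to a contradiction as in Liouville's theorem. *)
Section Resolvent.
Context (x : A) (r : R[i]^o -> A).
Hypothesis rP : forall z, cong_mod (bmul (x - z *: u) (r z)) u.

Lemma resolvent_identity z w :
  cong_mod (r z - r w) ((z - w) *: bmul (r w) (r z)).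
Proof.
have H v y : cong_mod (bmul y (bmul (x - v *: u) (r v))) y.
  by apply: (cong_trans (congM y (rP v))); exact: Mu.
apply: (cong_trans (cong_sym (congB (H w (r z)) (H z (r w))))).
rewrite [bmul (r z) _]bmulCA [bmul (r w) (bmul _ _)]bmulCA.
rewrite (bmulC (r z) (r w)) -bmulBl opprB addrC addrA subrK -scalerBl bmulZl.
by apply: congZ; rewrite bmulC; exact: Mu.
Qed.

(** Modulo [M], [z r(z) = x r(z) - u]. *)
Lemma resolvent_decay z :
  (rnorm z - qnorm x) * qnorm (r z) <= qnorm u.
Proof.
rewrite mulrBl -qnormZ lerBlDl; apply: le_trans (lerD (qnormM _ _) (lexx _)).
rewrite -[qnorm u]qnormN; apply: le_trans (qnormD _ _); apply: qnorm_cong.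
apply: cong_sym; apply: (cong_trans (congB (cong_refl _) (cong_sym (rP z)))).
by rewrite bmulBl opprB addrC subrK bmulZl bmulC; apply: congZ.
Qed.

(** The resolvent identity bounds [r z] by [2 K] near [w], where [K] is the
    seminorm of [r w], and then makes [r] locally Lipschitz. *)
Lemma resolvent_continuous : continuous (fun z => qnorm (r z)).
Proof.
move=> w; set K := qnorm (r w); have K0 : 0 <= K := qnorm_ge0 _.
have dist z : qnorm (r z - r w) <= rnorm (z - w) * (K * qnorm (r z)).
  apply: le_trans (qnorm_cong (resolvent_identity z w)) _.
  by rewrite qnormZ ler_wpM2l ?rnorm_ge0 // qnormM.
have qdist a b : `|qnorm a - qnorm b| <= qnorm (b - a).
  have H (v y : A) : qnorm v <= qnorm y + qnorm (v - y).
    by rewrite -{1}(subrKC y v) qnormD.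
  by rewrite ler_distl lerBlDr H -[b - a]opprB qnormN H.
apply/(@cvgrPdist_lt _ _ _ (nbhs (w : R[i]^o))) => e e0.
have /rnorm_cvgP near_w : (fun z : R[i]^o => z) @ nbhs w --> w by exact: cvg_id.
have K1 : 0 < K + 1 by rewrite ltr_wpDl.
have d0 : 0 < (2 * (K + 1))^-1 by rewrite invr_gt0 mulr_gt0.
have d1 : 0 < e * (2 * (K + 1) ^+ 2)^-1.
  by rewrite mulr_gt0 // invr_gt0 mulr_gt0 // exprn_gt0.
apply: filterS2 (near_w _ d0) (near_w _ d1) => z zw0 zw1.
apply: le_lt_trans (qdist _ _) _; apply: le_lt_trans (dist z) _.
rewrite rdistC in zw0 zw1.
have rz : qnorm (r z) <= 2 * K.
  have : qnorm (r z) <= K + rnorm (z - w) * (K * qnorm (r z)).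
    by rewrite -{1}(subrKC (r w) (r z)); apply: le_trans (qnormD _ _) _; rewrite lerD2l.
  suff : rnorm (z - w) * (K * qnorm (r z)) <= 2^-1 * qnorm (r z) by lra.
  rewrite mulrA ler_wpM2r ?qnorm_ge0 //.
  have : rnorm (z - w) * (K + 1) <= 2^-1.
    by rewrite -ler_pdivlMr // -invfM ltW.
  have := rnorm_ge0 (z - w); nra.
apply: le_lt_trans (ler_wpM2l (rnorm_ge0 _) (ler_wpM2l K0 rz)) _.
have : rnorm (z - w) * (2 * (K + 1) ^+ 2) < e.
  by rewrite -ltr_pdivlMr // mulr_gt0 // exprn_gt0.
have := rnorm_ge0 (z - w); rewrite expr2; nra.
Qed.

(** The four points of modulus [s] on the axes: the sums of their first three
    powers vanish, and their fourth powers are all [s^4]. *)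
Let c4 (s : R) (k : 'I_4) : R[i]^o := 'i%C ^+ k * s%:C%C.

Let c4_exp s j : (0 < j < 4)%N -> \sum_k c4 s k ^+ j = 0.
Proof.
have i2 := sqr_i R.
rewrite /c4 => jP; under eq_bigr do rewrite exprMn; rewrite -mulr_suml.
rewrite !big_ord_recr big_ord0 /= !expr0 !expr1n !expr1 add0r.
have -> : ('i%C ^+ 3 : R[i]) = - 'i%C by rewrite exprS i2 mulrN1.
rewrite i2; case: j jP => [|[|[|[|]]]] //= _.
- by rewrite !expr1; ring.
- by rewrite sqrrN sqrrN i2 expr1n; ring.
- by rewrite !(exprS _ 2) sqrrN sqrrN i2 expr1n; ring.
Qed.

Let c4_exp4 s k : c4 s k ^+ 4 = (s ^+ 4)%:C%C.
Proof.
rewrite /c4 exprMn -rmorphXn exprAC (_ : 'i%C ^+ 4 = 1) ?expr1n ?mul1r //.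
by rewrite (exprM _ 2 2) sqr_i sqrrN expr1n.
Qed.
(** A mean value inequality with fourth-order error.  Iterating the resolvent
    identity [y = a + c a y], where [a = r z] and [y = r (z + c)], four times
    gives [y = a + c a^2 + c^2 a^3 + c^3 a^4 + c^4 a^4 y]; summing over the four
    values of [c] leaves [Y = 4 a + s^4 a^4 Y], where [Y] is the sum of the four [y]. *)
Lemma four_point z s : 4 * qnorm (r z) <=
  (\sum_k qnorm (r (z + c4 s k))) * (1 + s ^+ 4 * qnorm (r z) ^+ 4).
Proof.
set a := r z; pose y k := r (z + c4 s k).
pose T (c : R[i]) v := a + c *: bmul a v.
pose L j v := iter j (bmul a) v.
have T4 c v : T c (T c (T c (T c v))) =
    a + c ^+ 1 *: L 1%N a + c ^+ 2 *: L 2%N a + c ^+ 3 *: L 3%N a + c ^+ 4 *: L 4%N v.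
  rewrite /T /L /= !(bmulDr, bmulZr, scalerDr, scalerA) !addrA.
  by rewrite expr1 -!expr2 -!exprSr.
have Tj j v : (0 < j < 4)%N -> \sum_k c4 s k ^+ j *: v = 0.
  by move=> j4; rewrite -scaler_suml c4_exp // scale0r.
have yT k : cong_mod (y k) (T (c4 s k) (y k)).
  have := congD (cong_refl a) (resolvent_identity (z + c4 s k) z).
  by rewrite subrKC addrAC subrr add0r.
have TT c v w : cong_mod v w -> cong_mod (T c v) (T c w).
  by move=> vw; apply: congD (cong_refl _) (congZ _ (congM _ vw)).
have y4 k : cong_mod (y k) (T (c4 s k) (T (c4 s k) (T (c4 s k) (T (c4 s k) (y k))))).
  do 3![apply: (cong_trans (yT k)); apply: (TT)]; exact: yT.
have sum_y : cong_mod (\sum_k y k) (4 *: a + (s ^+ 4)%:C%C *: L 4%N (\sum_k y k)).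
  have -> : 4 *: a + (s ^+ 4)%:C%C *: L 4%N (\sum_k y k) =
      \sum_k T (c4 s k) (T (c4 s k) (T (c4 s k) (T (c4 s k) (y k)))).
    under [RHS]eq_bigr do rewrite T4 c4_exp4.
    rewrite !big_split /= !Tj // !addr0 -scaler_sumr sumr_const card_ord.
    rewrite scaler_nat; congr (_ + _ *: _).
    by rewrite /L /= !bmul_sumr.
  elim/big_ind2: _ => [|v v' w w' vv' ww'|k _].
  - exact: cong_refl.
  - exact: congD.
  - exact: y4.
have LM v : qnorm (L 4%N v) <= qnorm a ^+ 4 * qnorm v.
  rewrite /L /= !exprS expr0 mulr1 -!mulrA.
  by do 3![apply: le_trans (qnormM _ _) _; rewrite ler_wpM2l ?qnorm_ge0 //];
     exact: qnormM.
set S := \sum_k _; have S0 : 0 <= S by apply: sumr_ge0 => k _; exact: qnorm_ge0.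
have yS : qnorm (\sum_k y k) <= S by exact: qnorm_sum.
have n4 : rnorm (4 : R[i]^o) = 4.
  have -> : (4 : R[i]^o) = (4%:R)%:C%C by rewrite rmorph_nat.
  by rewrite rnorm_real ger0_norm.
rewrite -[in X in X * _]n4 -qnormZ mulrDr mulr1.
have a4 : cong_mod (4 *: a) (\sum_k y k - (s ^+ 4)%:C%C *: L 4%N (\sum_k y k)).
  apply: cong_sym; have := congB sum_y (cong_refl ((s ^+ 4)%:C%C *: L 4%N (\sum_k y k))).
  by rewrite addrK.
apply: le_trans (qnorm_cong a4) _; apply: le_trans (qnormD _ _) _.
apply: lerD => //; rewrite qnormN (qnormZ (s ^+ 4)%:C%C) rnorm_real.
have s4 : 0 <= s ^+ 4 by rewrite (exprM _ 2 2) sqr_ge0.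
rewrite ger0_norm // [leRHS]mulrCA.
rewrite ler_wpM2l //; apply: le_trans (LM _) _.
by rewrite mulrC ler_wpM2r // exprn_ge0 // qnorm_ge0.
Qed.

(** The term [s^2] is the strict subharmonicity that beats the error [s^4] of
    [four_point]. *)
Lemma parallelogram z s :
  \sum_k rnorm (z + c4 s k) ^+ 2 = 4 * (rnorm z ^+ 2 + s ^+ 2).
Proof.
have sqE (w : R[i]^o) : rnorm w ^+ 2 = complex.Re w ^+ 2 + complex.Im w ^+ 2.
  by apply: complexI; rewrite rmorphXn /= -rnormE add_Re2_Im2.
under eq_bigr do rewrite sqE.
rewrite sqE /c4 !big_ord_recr big_ord0 /=.
have -> : ('i%C ^+ 3 : R[i]) = - 'i%C by rewrite exprS sqr_i mulrN1.
rewrite sqr_i expr0 expr1 mul1r mulN1r add0r.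
case: z => a b /=; rewrite ?mulr0 ?mul0r ?mul1r ?oppr0 ?subr0 ?addr0 ?add0r ?mulN1r.
ring.
Qed.

(** The function [f] is maximal at some [z0] of a large disc.  On the boundary
    this contradicts the decay of the resolvent at infinity, and inside it
    contradicts the comparison of [f z0] with the mean of [f] over four nearby
    points. *)
Lemma resolvent_absurd : False.
Proof.
pose N z := qnorm (r z).
have r_gt0 z : 0 < N z.
  rewrite lt_neqAle qnorm_ge0 andbT eq_sym; apply/eqP => rz0.
  have := qnorm_cong (cong_sym (rP z)).
  move=> /le_trans /(_ (qnormM _ _)); rewrite -/(N z) rz0 mulr0.
  by apply/negP; rewrite -ltNge (lt_le_trans ltr01) // qnorm_unit.
(* [rho] makes the decay bound at most half of [N 0] on the boundary, and [eps]
   makes the quadratic term there a quarter of [N 0]. *)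
pose rho := qnorm x + 2 * qnorm u / N 0.
have rho_gt0 : 0 < rho.
  rewrite ltr_wpDl ?qnorm_ge0 // divr_gt0 // mulr_gt0 //.
  exact: lt_le_trans qnorm_unit.
pose eps := N 0 / (4 * rho ^+ 2).
have eps0 : 0 < eps by rewrite divr_gt0 // mulr_gt0 // exprn_gt0.
pose f z := N z + eps * rnorm z ^+ 2.
pose D := [set z : R[i]^o | rnorm z <= rho].
have cf : {within D, continuous f}.
  have cN : continuous N by exact: resolvent_continuous.
  have cn : continuous (fun z : R[i]^o => rnorm z) by exact: rnorm_continuous.
  apply: continuous_subspaceT => z; apply: (cvgD (cN z)).
  by apply: cvgMr; exact: (cvgM (cn z) (cn z)).
have D0 : D 0 by rewrite /D /= rnorm0 ltW.
have [z0 + fmax] := compact_EVT_max (ex_intro _ _ D0) (@disc_compact R rho) cf.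
rewrite inE => z0D.
have [z0r|z0r] := ltP (rnorm z0) rho; last first.
  have z0E : rnorm z0 = rho by apply/eqP; rewrite eq_le z0r andbT.
  have := fmax 0; rewrite inE => /(_ D0); rewrite /f rnorm0 expr0n mulr0 addr0 z0E.
  have -> : eps * rho ^+ 2 = N 0 / 4.
    by rewrite /eps; field; rewrite gt_eqF.
  have := resolvent_decay z0; rewrite z0E /rho addrAC subrr add0r -/(N z0).
  rewrite mulrAC ler_pdivrMr // mulrAC (mulrC (qnorm u)) ler_pM2r; last first.
    exact: lt_le_trans qnorm_unit.
  have := r_gt0 0; lra.
set K := N z0.
have K0 : 0 < K by exact: r_gt0.
(* With this radius the error, at most [4 s^4 K^5], is smaller than the gain
   [4 eps s^2], and the four points stay in the disc. *)
pose s := Num.min (rho - rnorm z0) (Num.min 1 (eps / (2 * K ^+ 5))).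
have s0 : 0 < s.
  by rewrite !lt_min subr_gt0 z0r ltr01 divr_gt0 // mulr_gt0 // exprn_gt0.
have rc k : rnorm (c4 s k) = s.
  have i1 : rnorm ('i%C : R[i]^o) = 1.
    by apply: complexI; rewrite -rnormE normc_def /= expr0n expr1n add0r sqrtr1.
  rewrite /c4 rnormM rnorm_real gtr0_norm //.
  have -> : rnorm ('i%C ^+ k : R[i]^o) = 1; last by rewrite mul1r.
  elim: (k : nat) => [|j IH]; first by rewrite expr0 (rnorm_real 1) normr1.
  by rewrite exprS rnormM i1 mul1r.
have srho : s <= rho - rnorm z0 by rewrite ge_min lexx.
have : \sum_k f (z0 + c4 s k) <= \sum_(k < 4) f z0.
  apply: ler_sum => k _; apply: fmax; rewrite inE /D /=.
  by apply: le_trans (rnormD _ _) _; rewrite rc addrC -lerBrDr.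
rewrite sumr_const card_ord big_split /= -mulr_sumr parallelogram /f -/K.
have := four_point z0 s; rewrite -/(N z0) -/K; set S := \sum_k _.
move=> fp fS.
have S4 : S <= 4 * K.
  have : 0 <= eps * s ^+ 2 by rewrite mulr_ge0 ?exprn_ge0 // ltW.
  lra.
have fp4 : 4 * K <= S + s ^+ 4 * (4 * K ^+ 5).
  apply: le_trans fp _; rewrite mulrDr mulr1 lerD2l.
  have -> : s ^+ 4 * (4 * K ^+ 5) = 4 * K * (s ^+ 4 * K ^+ 4) by ring.
  by rewrite ler_wpM2r // mulr_ge0 // exprn_ge0 // ltW.
have : eps * s ^+ 2 <= s ^+ 4 * K ^+ 5 by lra.
have -> : s ^+ 4 * K ^+ 5 = (s ^+ 2 * K ^+ 5) * s ^+ 2 by ring.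
rewrite ler_pM2r ?exprn_gt0 //; apply/negP; rewrite -ltNge.
have s1 : s <= 1 by rewrite !ge_min lexx orbT.
have s2 : s * (2 * K ^+ 5) <= eps.
  by rewrite -ler_pdivlMr ?ge_min ?lexx ?orbT // mulr_gt0 // exprn_gt0.
have K5 : 0 < K ^+ 5 by rewrite exprn_gt0.
apply: le_lt_trans (_ : s * K ^+ 5 < _).
  by rewrite ler_pM2r // expr2 -[leRHS]mulr1 ler_pM2l.
lra.
Qed.
End Resolvent.

(** The Gelfand-Mazur theorem for [A / M]. *)
Lemma scalar_mod x : exists z : R[i], cong_mod x (z *: u).
Proof.
apply: contrapT => nz.
have xz z : exists y, cong_mod (bmul (x - z *: u) y) u.
  by apply: inverse_mod => xz; apply: nz; exists z.
have [r rP] := choice xz; exact: (resolvent_absurd rP).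
Qed.

Lemma scalar_mod_unique z w : cong_mod (z *: u) (w *: u) -> z = w.
Proof.
rewrite /cong_mod -scalerBl => zwM; apply/eqP; rewrite -subr_eq0.
apply/negPn/negP => zw0; apply: unit_notin.
by rewrite -[u]scale1r -(mulVf zw0) -scalerA; exact: MZ.
Qed.

(** The scalar of [scalar_mod] is the value of the character. *)
Lemma maximal_modular_character : exists phi : character_space A,
  forall x, character_fun phi x = 0 -> M x.
Proof.
have [h hP] := choice scalar_mod.
have hE x z : cong_mod x (z *: u) -> h x = z.
  by move=> xz; apply: scalar_mod_unique; apply: cong_trans xz; apply: cong_sym.
have h_char : is_character (h : {ptws A -> R[i]^o}).
  split.
  - move=> c x y; apply: hE; rewrite scalerDl -scalerA.
    by apply: congD; [apply: congZ|]; exact: hP.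
  - move=> x y; apply: hE; rewrite mulrC -scalerA.
    apply: (cong_trans (congM x (hP y))); rewrite bmulZr; apply: congZ.
    exact: (cong_trans (Mu x)).
  - exists u; rewrite (hE u 1) ?scale1r; last exact: cong_refl.
    by apply/eqP; exact: oner_neq0.
exists (mk_character h_char) => x; rewrite mk_characterE => hx.
by have := hP x; rewrite hx scale0r /cong_mod subr0.
Qed.

End MaximalModularIdeal.

(** An element killed by all characters lies in every maximal modular ideal,
    hence in the radical. *)
Lemma semisimple_characters_separate (R : realType) (A : comBanachAlgType R) :
  semisimple A -> @characters_separate R A.
Proof.
move=> ss a a0; have : [set 0] a; last by [].
rewrite -ss => M /= Mmax; have [_ [u Mu] _ _] := Mmax.
have [phi] := maximal_modular_character Mmax Mu; apply; exact: a0.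
Qed.

(** * Non-periodic points and Baire category *)

Section CharacterSpaceTopology.
Context {R : realType} {A : comBanachAlgType R}.
Implicit Types (a b : A) (phi : character_space A).

Definition gabs a phi : R := rnorm (gelfand a phi).

Lemma gabs_continuous a : continuous (gabs a).
Proof.
move=> phi; have /cvg_character_space /(_ a) ga : nbhs phi --> phi by [].
exact: rnorm_cvg ga.
Qed.

Lemma gabs_gt_open a (t : R) : open [set phi | t < gabs a phi].
Proof.
by apply: (open_comp _ (@open_gt R t)) => phi _; exact: gabs_continuous.
Qed.

Lemma gabs_gt0 a phi : (0 < gabs a phi) = (character_fun phi a != 0).
Proof.
by rewrite lt_neqAle rnorm_ge0 andbT eq_sym rnorm_eq0.
Qed.

(** A finite intersection property: characters are bounded by the norm, so by
    Tychonoff's theorem the characters satisfying the first [k] conditions have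
    a cluster point among all functions [A -> R[i]].  The conditions, and being
    additive, homogeneous and multiplicative, are closed; the limit is
    non-zero because of the first condition. *)
Lemma gabs_ge1_fip (b : nat -> A) :
  (forall k, exists phi, forall j, (j <= k)%N -> 1 <= gabs (b j) phi) ->
  exists phi, forall k, 1 <= gabs (b k) phi.
Proof.
move=> /choice[phi_ phiP].
pose X : topologicalType := {ptws A -> R[i]^o}.
have ev_cont a : continuous (fun f : X => f a).
  exact: (@proj_continuous _ (fun _ : A => R[i]^o : topologicalType) a).
pose s k : X := set_val (phi_ k).
have [f [_ sf]] : [set f : X | forall a, rnorm (f a) <= rnorm a]
    `&` cluster (s @ \oo) !=set0.
  apply: (@tychonoff A (fun _ => R[i]^o : topologicalType)
    (fun a => [set z : R[i]^o | rnorm z <= rnorm a])) => [a|].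
    exact: disc_compact.
  by exists 0%N => // k _ a; exact: character_le_norm.
have in_closed (E : set X) k : closed E -> (forall j, (k <= j)%N -> E (s j)) -> E f.
  move=> cE sE; apply: cE => B Bf; apply: sf => //.
  by exists k => // j kj; exact: sE.
have zero_closed (g : X -> R[i]^o) : continuous g -> closed [set h | rnorm (g h) <= 0].
  move=> gc; apply: (closed_comp _ (@closed_le R 0)) => h _.
  exact: rnorm_cvg (gc h).
have f_zero (g : X -> R[i]^o) : continuous g -> (forall j, g (s j) = 0) -> g f = 0.
  move=> gc gs; apply/eqP; rewrite -rnorm_eq0 eq_le rnorm_ge0 andbT.
  by apply: (in_closed _ 0%N (zero_closed g gc)) => j _; rewrite /= gs rnorm0.
have f_big k : 1 <= rnorm (f (b k)).
  apply: (in_closed [set h : X | 1 <= rnorm (h (b k))] k).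
    apply: (closed_comp _ (@closed_ge R 1)) => h _.
    exact: rnorm_cvg (ev_cont _ h).
  by move=> j kj; exact: phiP.
have f_char : is_character f.
  split.
  - move=> c x y; apply/eqP; rewrite -subr_eq0; apply/eqP.
    apply: (f_zero (fun h : X => h (c *: x + y) - (c * h x + h y))) => [h|j].
      exact: (cvgB (ev_cont (c *: x + y) h)
        (cvgD (cvgM (cvg_cst (c : R[i]^o)) (ev_cont x h)) (ev_cont y h))).
    by rewrite [s j _]characterD characterZ subrr.
  - move=> x y; apply/eqP; rewrite -subr_eq0; apply/eqP.
    apply: (f_zero (fun h : X => h (bmul x y) - h x * h y)) => [h|j].
      exact: (cvgB (ev_cont (bmul x y) h) (cvgM (ev_cont x h) (ev_cont y h))).
    by rewrite [s j _]characterM subrr.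
  - exists (b 0%N) => fb0; have := f_big 0%N.
    by rewrite fb0 rnorm0 ler10.
by exists (mk_character f_char) => k; rewrite /gabs /gelfand mk_characterE.
Qed.

End CharacterSpaceTopology.

Section DenseAperiodicity.
Context {R : realType} {A : comBanachAlgType R}.
Variable sigma : algebra_aut A.
Hypothesis sep : @characters_separate R A.

Lemma dense_fixed_points_support_nothing :
  dense (nonperiodic_points sigma) -> fixed_points_support_nothing sigma.
Proof.
move=> dn n n0 a a_van; apply: sep => phi; apply/eqP/negPn/negP.
rewrite -gabs_gt0 => phia.
have [|psi [psia psin]] := dn _ _ (gabs_gt_open a 0); first by exists phi.
move: psia; rewrite /= gabs_gt0 a_van ?eqxx //.
by apply: psin; exact/eqP.
Qed.

Hypothesis Acr : completely_regular A.

(** Complete regularity gives small neighbourhoods of the form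
    [1 < gabs a], whose closures lie in the compact sets [1 <= gabs a]. *)
Lemma bump_function (W : set (character_space A)) phi : open W -> W phi ->
  exists a, 1 < gabs a phi /\ forall psi, 1 <= gabs a psi -> W psi.
Proof.
move=> oW Wphi; have [||a [aW aphi]] := @Acr (~` W) phi.
- exact: open_closedC.
- by [].
have {}aphi : 0 < gabs a phi by rewrite gabs_gt0; exact/eqP.
pose t := 2 / gabs a phi; have t0 : 0 < t by rewrite divr_gt0.
have bE psi : gabs (t%:C%C *: a) psi = t * gabs a psi.
  by rewrite /gabs /gelfand characterZ rnormM rnorm_real gtr0_norm.
exists (t%:C%C *: a); split.
  by rewrite bE mulfVK ?gt_eqF // ltr1n.
move=> psi; apply: contraPP => Wpsi.
by rewrite bE /gabs aW // rnorm0 mulr0 ler10.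
Qed.

(** The induction step of the Baire argument.  A point of [W] that is not fixed
    exists because an element supported in [W] would otherwise vanish off the
    fixed points; a character is not fixed as soon as it does not vanish on
    some [sigma^n c - c], which is an open condition. *)
Lemma escape_fixed_points : fixed_points_support_nothing sigma ->
  forall (W : set (character_space A)) n, open W -> W !=set0 -> n != 0 ->
  exists a, [set phi | 1 < gabs a phi] !=set0 /\
    forall phi, 1 <= gabs a phi -> W phi /\ ~ fixed_points sigma n phi.
Proof.
move=> P W n oW [phi1 Wphi1] n0.
have [phi0 [Wphi0 nfix]] : exists phi, W phi /\ ~ fixed_points sigma n phi.
  apply: contrapT => noPhi; have [a [a1 aW]] := bump_function oW Wphi1.
  have [||c [cW cphi]] := @Acr (~` W) phi1; [exact: open_closedC|by []|].
  apply: cphi; rewrite (P n n0 c) ?[gelfand _ _]character0 // => phi nfix.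
  by apply: cW => Wphi; apply: noPhi; exists phi.
have [c cphi0] : exists c, character_fun phi0 (aut_pow sigma n c - c) <> 0.
  apply: contrapT => noC; apply: nfix; apply/fixed_pointsP => c.
  apply/eqP; rewrite -subr_eq0 -characterB; apply/negPn/negP => /eqP cphi.
  by apply: noC; exists c.
pose d := aut_pow sigma n c - c.
have [||a [aphi aW]] := @bump_function (W `&` [set phi | 0 < gabs d phi]) phi0.
- by apply: openI => //; exact: gabs_gt_open.
- by split=> //; rewrite /= gabs_gt0; exact/eqP.
exists a; split; first by exists phi0.
move=> phi /aW[Wphi /=]; rewrite gabs_gt0 => /eqP dphi.
split=> // /fixed_pointsP fix_phi.
by apply: dphi; rewrite characterB fix_phi subrr.
Qed.

(** Inside an open set, nested sets [1 <= gabs (b k)] avoid the fixed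
    points of one positive power after the other; their intersection is
    non-empty by compactness. *)
Lemma fixed_points_support_nothing_dense :
  fixed_points_support_nothing sigma -> dense (nonperiodic_points sigma).
Proof.
move=> P W W0 oW; have esc := escape_fixed_points P.
(* States carry the index [k] reached so far; the set built at stage [k]
   avoids the fixed points of the power [k + 1]. *)
pose T := {p : nat * A | [set phi | 1 < gabs p.2 phi] !=set0}.
have [b0 [b0n b0P]] := esc W 1 oW W0 isT.
pose next (p q : T) := (sval q).1 = (sval p).1.+1 /\
  forall phi, 1 <= gabs (sval q).2 phi -> 1 < gabs (sval p).2 phi /\
    ~ fixed_points sigma ((sval q).1.+1)%:Z phi.
have step (p : T) : {q : T | next p q}.
  apply: cid; case: p => -[k a] /= an.
  have [b [bn bP]] := esc _ k.+2%:Z (gabs_gt_open a 1) an isT.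
  by exists (exist _ (k.+1, b) bn).
have [g [g0 gS]] := dependent_choice step (exist _ (0%N, b0) b0n).
pose b k := (sval (g k)).2.
have g1 k : (sval (g k)).1 = k.
  by elim: k => [|k IH]; [rewrite g0|rewrite (gS k).1 IH].
have nested j k : (j <= k)%N -> forall phi, 1 <= gabs (b k) phi -> 1 <= gabs (b j) phi.
  move=> /subnKC <-; elim: (k - j)%N => [|i IH] phi; first by rewrite addn0.
  by rewrite addnS => /(gS _).2[/ltW + _]; exact: IH.
have [k|phi phiP] := @gabs_ge1_fip _ _ b.
  have [phi /ltW phib] := svalP (g k).
  by exists phi => j jk; exact: nested jk _ phib.
have [Wphi nfix1] : W phi /\ ~ fixed_points sigma 1 phi.
  by apply: b0P; have := phiP 0%N; rewrite /b g0.
have nfix k : ~ fixed_points sigma k.+1%:Z phi.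
  case: k => [//|k]; have := ((gS k).2 phi (phiP k.+1)).2.
  by rewrite g1.
exists phi; split=> // -[[//|k]|k] _ fix_phi; first exact: (nfix k fix_phi).
by apply: (nfix k); apply/fixed_pointsN; rewrite -NegzE.
Qed.

End DenseAperiodicity.

(** * The three properties *)

Theorem theorem6p2 (R : realType) (A : comBanachAlgType R)
    (Ass : semisimple A) (Acr : completely_regular A)
    (sigma : algebra_aut A) :
  (dense (nonperiodic_points sigma) <-> nonzero_ideals_meet_base sigma) /\
  (nonzero_ideals_meet_base sigma <->
   maximal_abelian_subalgebra (cp_base sigma)).
Proof.
have sep := semisimple_characters_separate Ass.
have dense_iff : dense (nonperiodic_points sigma) <->
    fixed_points_support_nothing sigma.
  split; first exact: dense_fixed_points_support_nothing.
  exact: fixed_points_support_nothing_dense.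
have ideals_iff : nonzero_ideals_meet_base sigma <->
    fixed_points_support_nothing sigma.
  split; first exact: ideals_fixed_points_support_nothing.
  exact: fixed_points_support_nothing_ideals.
have max_iff : fixed_points_support_nothing sigma <->
    maximal_abelian_subalgebra (cp_base sigma).
  exact: fixed_points_support_nothing_max_abelian.
by tauto.
Qed.
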